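(* Let $\Sigma$ be a closed orientable surface with a tiling by quadrilaterals whose vertices are colored black and white so that every edge joins a black vertex to a white vertex, and fix an equivalence relation on the set of white vertices. Fix one tile $T_0$ whose two white vertices are not equivalent. Then the incidence theorem generated by this tiling (with conclusion tile $T_0$), as described in the context, is an absolute incidence theorem: for every commutative ring $A$ and every $3\times n$ matrix with entries in $A$ (columns indexed by the $n$ elements of the set $S$ below) such that (1) the entries of each column generate the unit ideal of $A$, (2) for each nondegeneracy pair $\{a,b\}$, the three $2\times 2$ minors using columns $a$ and $b$ generate the unit ideal, (3) for each nondegeneracy triple $\{a,b,c\}$, the $3\times 3$ minor with columns $a,b,c$ is a unit of $A$, (4) for each collinearity triple $\{a,b,c\}$, the $3\times 3$ minor with columns $a,b,c$ equals $0$, the $3\times 3$ minor with columns given by the conclusion triple is $0$.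
   Context: The incidence theorem generated by the tiling is the following data. The ground set $S$ consists of: all black vertices; two elements $s_i,t_i$ for each equivalence class $i$ of white vertices; and one element $R_k$ for each (unordered) pair $k=\{i,j\}$ of distinct equivalence classes of white vertices which appear together in some tile (i.e., some tile has one white vertex in class $i$ and the other in class $j$). Nondegeneracy conditions: the pair $\{s_i,t_i\}$ for each class $i$; the triples $\{s_i,t_i,t_j\},\{s_i,t_i,s_j\},\{s_i,s_j,t_j\},\{t_i,s_i,s_j\}$ for each pair of distinct classes $i,j$; and the triple $\{s_i,t_i,P\}$ for each class $i$ and black vertex $P$ which appear together in a tile. Collinearity conditions: $\{s_i,t_i,R_k\}$ and $\{s_j,t_j,R_k\}$ for each pair $k=\{i,j\}$ of distinct classes appearing in a tile together; and, for every tile other than $T_0$ whose two white vertices are not equivalent, the triple $\{P,Q,R_k\}$, where $P,Q$ are the black vertices of that tile and $R_k$ is the element associated to the pair of classes of its two white vertices. The conclusion is the triple $\{P,Q,R_k\}$ where $P,Q$ are the black vertices of $T_0$ and $R_k$ is the element associated to the classes of the white vertices of $T_0$. (Over a field, columns represent points of $\mathbb{P}^2$ and the minor conditions express distinctness, non-collinearity, collinearity.) *)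

(* Defs.v *)
From HB Require Import structures.
From mathcomp Require Import all_boot all_order all_algebra all_fingroup.

Set Implicit Arguments.
Unset Strict Implicit.
Unset Printing Implicit Defensive.

Import GRing.Theory.
Local Open Scope ring_scope.

(** * Absolute incidence theorems *)

(* The conditions imposed below on 2- and 3-tuples of elements do not depend
   on the order of the entries, so tuples stand for the unordered pairs and
   triples. *)
Record incidence_theorem := IncidenceTheorem {
  ground : finType;
  nondeg_pair : 2.-tuple ground -> Prop;
  nondeg_triple : 3.-tuple ground -> Prop;
  collinear_triple : 3.-tuple ground -> Prop;
  conclusion : 3.-tuple ground
}.

Section Absolute.

Variables (A : comPzRingType) (S : finType) (M : 'M[A]_(3, #|S|)).

Definition is_unit (x : A) : Prop := exists y, y * x = 1.

Definition generate_unit_ideal (I : finType) (x : I -> A) : Prop :=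
  exists c : I -> A, \sum_i c i * x i = 1.

Definition columns (k : nat) (s : k.-tuple S) : 'M[A]_(3, k) :=
  colsub (fun j => enum_rank (tnth s j)) M.

(* The 2 x 2 minor obtained by deleting row [r]. *)
Definition minor2 (s : 2.-tuple S) (r : 'I_3) : A :=
  \det (rowsub (lift r) (columns s)).

Definition minor3 (s : 3.-tuple S) : A := \det (columns s).

End Absolute.

Definition absolute (I : incidence_theorem) : Prop :=
  forall (A : comPzRingType) (M : 'M[A]_(3, #|ground I|)),
    (forall a : ground I, generate_unit_ideal (fun r => M r (enum_rank a))) ->
    (forall s, nondeg_pair s -> generate_unit_ideal (minor2 M s)) ->
    (forall s, nondeg_triple s -> is_unit (minor3 M s)) ->
    (forall s, collinear_triple s -> minor3 M s = 0) ->
    minor3 M (conclusion I) = 0.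

(** * Tilings of closed oriented surfaces by quadrilaterals *)

(* A tiling of a closed surface is encoded by its combinatorial map.  A dart is
   an edge of the tiling together with one of its two directions, or
   equivalently, once the surface is oriented, a side of a tile traversed
   counterclockwise.  [reverse] reverses darts, so that each side is glued to
   exactly one other side, with opposite directions; [next_side] maps a side
   of a tile to the following side of the same tile.  The tiles are the orbits
   of [next_side]. *)
Record quad_tiling := QuadTiling {
  dart : finType;
  reverse : {perm dart};
  next_side : {perm dart};
  reverse_involutive : involutive reverse;
  reverse_neq : forall d, reverse d != d;
  tile_size : forall d, #|porbit next_side d| = 4%N
}.

Section Cells.

Variable X : quad_tiling.

Definition tile := {T : {set dart X} | T \in porbits (next_side X)}.

Definition tile_of (d : dart X) : tile :=
  exist _ (porbit (next_side X) d) (imset_f _ (erefl (d \in predT))).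

(* [around d = next_side (reverse d)] is the dart following [d] in the
   rotation around the origin of [d]; vertices are the orbits of [around]. *)
Definition around : {perm dart X} := (reverse X * next_side X)%g.

Definition vertex := {v : {set dart X} | v \in porbits around}.

Definition origin (d : dart X) : vertex :=
  exist _ (porbit around d) (imset_f _ (erefl (d \in predT))).

Lemma origin_next d : origin (next_side X d) = origin (reverse X d).
Proof.
apply: val_inj => /=; have := porbit_perm around 1 (reverse X d).
by rewrite expg1 /around permM reverse_involutive.
Qed.

End Cells.

(* The edge carrying [d] joins [origin d] and [origin (reverse d)]. *)
Record bicolored_tiling := BicoloredTiling {
  tiling :> quad_tiling;
  black : pred (vertex tiling);
  black_reverse : forall d,
    black (origin (reverse tiling d)) = ~~ black (origin d)
}.

Section Corners.

Variable X : bicolored_tiling.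

Definition black_vertex := {v : vertex X | black v}.
Definition white_vertex := {v : vertex X | ~~ black v}.

Lemma black_next d : black (origin (next_side X d)) = ~~ black (origin d).
Proof. by rewrite origin_next black_reverse. Qed.

(* A black corner of a tile is represented by the side of the tile that
   originates there. *)
Definition black_corner := {d : dart X | black (origin d)}.

Definition corner_black (c : black_corner) : black_vertex :=
  exist _ (origin (val c)) (valP c).

Lemma next_whiteP (c : black_corner) : ~~ black (origin (next_side X (val c))).
Proof. by rewrite black_next negbK (valP c). Qed.

Definition corner_white (c : black_corner) : white_vertex :=
  exist _ (origin (next_side X (val c))) (next_whiteP c).

Lemma opposite_blackP (c : black_corner) :
  black (origin (next_side X (next_side X (val c)))).
Proof. by rewrite !black_next negbK (valP c). Qed.

Definition opposite (c : black_corner) : black_corner :=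
  exist _ (next_side X (next_side X (val c))) (opposite_blackP c).

Lemma tile_black_cornerP (T : tile X) :
  exists c : black_corner, tile_of (val c) == T.
Proof.
case: T => T TX; have /imsetP[d _ defT] := TX.
case: (boolP (black (origin d))) => bd.
  by exists (exist _ d bd); rewrite -val_eqE /= defT.
have bnd : black (origin (next_side X d)) by rewrite black_next.
exists (exist _ (next_side X d) bnd); rewrite -val_eqE /= defT.
by have := porbit_perm (next_side X) 1 d; rewrite expg1 => ->.
Qed.

(* The four vertices of [T] are, in cyclic order, [tile_P T], [tile_U T],
   [tile_Q T], [tile_W T].  The two choices for the black corner at which to
   start differ by exchanging [tile_P] with [tile_Q] and [tile_U] with
   [tile_W]. *)
Definition tile_corner (T : tile X) : black_corner :=
  xchoose (tile_black_cornerP T).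

Definition tile_P (T : tile X) : black_vertex := corner_black (tile_corner T).
Definition tile_Q (T : tile X) : black_vertex :=
  corner_black (opposite (tile_corner T)).
Definition tile_U (T : tile X) : white_vertex := corner_white (tile_corner T).
Definition tile_W (T : tile X) : white_vertex :=
  corner_white (opposite (tile_corner T)).

End Corners.

(** * The incidence theorem generated by a tiling *)

Section Generated.

Variables (X : bicolored_tiling) (E : equiv_rel (white_vertex X)).

Definition white_class :=
  {i : {set white_vertex X} | i \in equivalence_partition E setT}.

Definition white_class_of (w : white_vertex X) : white_class :=
  exist _ [set y in setT | E w y] (imset_f _ (in_setT w)).

Lemma white_class_of_neq u w : ~~ E u w -> white_class_of u != white_class_of w.
Proof.
apply: contra => /eqP/(congr1 val)/= /setP/(_ w).
by rewrite !inE /= equiv_refl.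
Qed.

Definition tile_classes (T : tile X) : {set white_class} :=
  [set white_class_of (tile_U T); white_class_of (tile_W T)].

Definition is_class_pair (k : {set white_class}) : bool :=
  [exists T : tile X,
     (white_class_of (tile_U T) != white_class_of (tile_W T)) &&
     (k == tile_classes T)].

Definition class_pair := {k : {set white_class} | is_class_pair k}.

Lemma tile_pairP (T : tile X) :
  ~~ E (tile_U T) (tile_W T) -> is_class_pair (tile_classes T).
Proof.
by move=> UW; apply/existsP; exists T; rewrite eqxx andbT white_class_of_neq.
Qed.

Definition tile_pair (T : tile X) (UW : ~~ E (tile_U T) (tile_W T)) :
  class_pair := exist _ (tile_classes T) (tile_pairP UW).

Definition tiling_ground : finType :=
  (black_vertex X + (white_class + white_class) + class_pair)%type.

Definition elt_black (P : black_vertex X) : tiling_ground := inl (inl P).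
Definition elt_s (i : white_class) : tiling_ground := inl (inr (inl i)).
Definition elt_t (i : white_class) : tiling_ground := inl (inr (inr i)).
Definition elt_R (k : class_pair) : tiling_ground := inr k.

Definition in_common_tile (i : white_class) (P : black_vertex X) : Prop :=
  exists T : tile X,
    (i = white_class_of (tile_U T) \/ i = white_class_of (tile_W T)) /\
    (P = tile_P T \/ P = tile_Q T).

Inductive tiling_nondeg_pair : 2.-tuple tiling_ground -> Prop :=
| Nondeg_st i : tiling_nondeg_pair [tuple elt_s i; elt_t i].

(* [i] and [j] range over ordered pairs of distinct classes, so that every
   3-element subset of [{s_i, t_i, s_j, t_j}] is covered. *)
Inductive tiling_nondeg_triple : 3.-tuple tiling_ground -> Prop :=
| Nondeg_sitisj i j : i != j ->
    tiling_nondeg_triple [tuple elt_s i; elt_t i; elt_s j]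
| Nondeg_sititj i j : i != j ->
    tiling_nondeg_triple [tuple elt_s i; elt_t i; elt_t j]
| Nondeg_sisjtj i j : i != j ->
    tiling_nondeg_triple [tuple elt_s i; elt_s j; elt_t j]
| Nondeg_tisjtj i j : i != j ->
    tiling_nondeg_triple [tuple elt_t i; elt_s j; elt_t j]
| Nondeg_stP i P : in_common_tile i P ->
    tiling_nondeg_triple [tuple elt_s i; elt_t i; elt_black P].

Definition tile_triple (T : tile X) (UW : ~~ E (tile_U T) (tile_W T)) :
  3.-tuple tiling_ground :=
  [tuple elt_black (tile_P T); elt_black (tile_Q T); elt_R (tile_pair UW)].

Inductive tiling_collinear (T0 : tile X) : 3.-tuple tiling_ground -> Prop :=
| Collinear_stR (k : class_pair) i : i \in val k ->
    tiling_collinear T0 [tuple elt_s i; elt_t i; elt_R k]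
| Collinear_tile T (UW : ~~ E (tile_U T) (tile_W T)) : T != T0 ->
    tiling_collinear T0 (tile_triple UW).

Definition tiling_incidence_theorem (T0 : tile X)
    (UW0 : ~~ E (tile_U T0) (tile_W T0)) : incidence_theorem :=
  {| ground := tiling_ground;
     nondeg_pair := tiling_nondeg_pair;
     nondeg_triple := tiling_nondeg_triple;
     collinear_triple := tiling_collinear T0;
     conclusion := tile_triple UW0 |}.

End Generated.

(* Main.v *)
Require Import Defs.
From mathcomp Require Import all_boot all_order all_algebra all_fingroup.
From mathcomp Require Import ring.

(** Write [f i P] for the determinant of [s_i], [t_i], [P].  If [R] is the
    common point of the lines [s_i t_i] and [s_j t_j], then [P], [Q], [R] are
    collinear iff [f i P * f j Q = f j P * f i Q].  Multiply these equations
    over all the tiles: each side is the product of [f] over all the edges of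
    the tiling, as each edge borders two tiles and contributes once to each
    side.  Since the [f i P] are units, the equation of [T_0] follows from all
    the others. *)

Set Implicit Arguments.
Unset Strict Implicit.
Unset Printing Implicit Defensive.

Import GRing.Theory.
Local Open Scope ring_scope.

(** * Units and vectors of length 3 over a commutative ring *)

Section Units.

Variable A : comPzRingType.
Implicit Types x y z : A.

Lemma is_unitM x y : is_unit x -> is_unit y -> is_unit (x * y).
Proof.
move=> [x' x'x] [y' y'y]; exists (y' * x').
by rewrite mulrA -(mulrA y') x'x mulr1.
Qed.

Lemma is_unit_prod (I : finType) (P : pred I) (F : I -> A) :
  (forall i, P i -> is_unit (F i)) -> is_unit (\prod_(i | P i) F i).
Proof.
move=> uF; apply: (big_ind (@is_unit A)) => //; last exact: is_unitM.
by exists 1; rewrite mulr1.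
Qed.

Lemma is_unit_mulIr x y z : is_unit z -> x * z = y * z -> x = y.
Proof.
move=> [z' z'z] xz_yz.
by rewrite -[x]mulr1 -[y]mulr1 -z'z !(mulrC z') !mulrA xz_yz.
Qed.

Lemma prod_eq_cancel (I : finType) (i0 : I) (F G : I -> A) :
  (forall i, i != i0 -> F i = G i) -> (forall i, is_unit (G i)) ->
  \prod_i F i = \prod_i G i -> F i0 = G i0.
Proof.
move=> FG uG; rewrite (bigD1 i0) //= (eq_bigr _ FG) [RHS](bigD1 i0) //=.
by apply: is_unit_mulIr; apply: is_unit_prod.
Qed.

End Units.

Section Vectors.

Variable A : comPzRingType.

Definition vec3 : Type := A * A * A.

Implicit Types (u v w x l m p q r : vec3).

Definition dot u v : A := u.1.1 * v.1.1 + u.1.2 * v.1.2 + u.2 * v.2.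

Definition cross u v : vec3 :=
  (u.1.2 * v.2 - u.2 * v.1.2,
   u.2 * v.1.1 - u.1.1 * v.2,
   u.1.1 * v.1.2 - u.1.2 * v.1.1).

(** This is the Binet-Cauchy identity. *)
Lemma dot_cross_cross u v w x :
  dot (cross u v) (cross w x) = dot u w * dot v x - dot u x * dot v w.
Proof. rewrite /dot /cross /=; ring. Qed.

Lemma dot_cross_diag u v : dot (cross u v) u = 0.
Proof. rewrite /dot /cross /=; ring. Qed.

Lemma dotC u v : dot u v = dot v u.
Proof. rewrite /dot; ring. Qed.

(* A vector orthogonal to [l] and [m] is parallel to [cross l m]. *)
Lemma dot_cross_parallel u v l m r : dot l r = 0 -> dot m r = 0 ->
  dot u r * dot v (cross l m) = dot u (cross l m) * dot v r.
Proof.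
move=> lr mr; apply/eqP; rewrite -subr_eq0 -dot_cross_cross.
(* The triple product expands to [(dot m r) l - (dot l r) m]. *)
rewrite (_ : cross r (cross l m) = (0, 0, 0)); last first.
  have tripleE (y z : A) : dot m r * y - dot l r * z = 0.
    by rewrite lr mr !mul0r subr0.
  congr (_, _, _); rewrite /=.
  - by rewrite -(tripleE l.1.1 m.1.1) /dot; ring.
  - by rewrite -(tripleE l.1.2 m.1.2) /dot; ring.
  by rewrite -(tripleE l.2 m.2) /dot; ring.
by rewrite /dot /= !mulr0 !addr0.
Qed.

(** The two sides differ by [dot (cross p q) (cross l m)]. As [cross l m] is parallel to [r] and
    [dot c r = 1], this is a multiple of [dot (cross p q) r]. *)
Lemma collinear_meet_cross l m p q r c : dot l r = 0 -> dot m r = 0 ->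
  dot c r = 1 -> dot (cross p q) r = 0 ->
  dot l p * dot m q = dot m p * dot l q.
Proof.
move=> lr mr cr pqr; have := dot_cross_parallel c (cross p q) lr mr.
rewrite cr pqr mulr0 mul1r dot_cross_cross !(dotC p) !(dotC q).
by move/eqP; rewrite subr_eq0 => /eqP.
Qed.

(** For this converse, [cross l m] must pair to a unit with some vector: [cross t' s] is one,
    because [s] lies on [l]. *)
Lemma cross_collinear_meet s t s' t' p q r
    (l := cross s t) (m := cross s' t') :
  dot l r = 0 -> dot m r = 0 -> is_unit (dot l t') -> is_unit (dot m s) ->
  dot l p * dot m q = dot m p * dot l q -> dot (cross p q) r = 0.
Proof.
move=> lr mr ult ums lmpq.
apply: (is_unit_mulIr (is_unitM ult ums)); rewrite mul0r mulrC.
have <- : dot (cross t' s) (cross l m) = dot l t' * dot m s.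
  rewrite dot_cross_cross (dotC s l) (dot_cross_diag s t) mulr0 subr0.
  by rewrite (dotC t') (dotC s).
rewrite -dot_cross_parallel // dot_cross_cross !(dotC p) !(dotC q) lmpq.
by rewrite subrr mulr0.
Qed.

End Vectors.

Section Columns.

Variables (A : comPzRingType) (S : finType) (M : 'M[A]_(3, #|S|)).

Definition column_vec (a : S) : vec3 A :=
  (M 0 (enum_rank a), M 1 (enum_rank a), M (1 + 1) (enum_rank a)).

Lemma minor3E (a b c : S) : minor3 M [tuple a; b; c] =
  dot (cross (column_vec a) (column_vec b)) (column_vec c).
Proof.
rewrite /minor3 (expand_det_col _ 0) !big_ord_recl big_ord0 /cofactor.
rewrite !(expand_det_col _ 0) !big_ord_recl !big_ord0 /cofactor !det_mx11 !mxE.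
(* Indexing rows by naturals lets the different ordinal terms for one row compute to the same atom
   for [ring]. *)
pose N (i : nat) j := M (inord i) j.
have ME i j : M i j = N i j by rewrite /N inord_val.
rewrite /dot /cross /column_vec !ME /tnth /= /bump /=; ring.
Qed.

Lemma column_vec_unimodular (a : S) :
  generate_unit_ideal (fun r => M r (enum_rank a)) ->
  exists c, dot c (column_vec a) = 1.
Proof.
move=> [c]; rewrite !big_ord_recl big_ord0 addr0 addrA => c1.
exists (c 0, c 1, c (1 + 1)); rewrite -[RHS]c1 /dot /column_vec /=.
by congr (_ * M _ _ + c _ * M _ _ + c _ * M _ _); apply: val_inj.
Qed.

End Columns.

(** * Products over the black corners of a tiling *)

Section BlackCorners.

Variable X : bicolored_tiling.
Implicit Types (c : black_corner X) (T : tile X).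

Lemma next_side4 (d : dart X) : iter 4 (next_side X) d = d.
Proof. by rewrite -{1}(tile_size d) iter_porbit. Qed.

Lemma oppositeK : involutive (@opposite X).
Proof. by move=> c; apply: val_inj; apply: next_side4. Qed.

Lemma opposite_neq c : opposite c != c.
Proof.
have := uniq_traject_porbit (next_side X) (val c).
rewrite tile_size /= !inE !negb_or => /andP[/and3P[_ + _] _].
by rewrite -val_eqE /= eq_sym.
Qed.

(** Colors alternate around a tile, so two of its four sides start at white vertices and only [c]
    and [opposite c] are left. *)
Lemma tile_of_eq c c' :
  (tile_of (val c') == tile_of (val c)) = (c' == c) || (c' == opposite c).
Proof.
rewrite -val_eqE [LHS]eq_porbit_mem porbit_traject tile_size /= !inE.
rewrite -(inj_eq val_inj c' c) -(inj_eq val_inj c' (opposite c)) /=.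
have bF d : black (origin d) = false -> (val c' == d) = false.
  by move=> bd; apply/eqP => dc; move: (valP c'); rewrite dc bd.
rewrite (bF (next_side X (val c))) ?black_next ?(valP c) //.
rewrite (bF (iter 3 (next_side X) (val c))) ?orbF //.
by rewrite !black_next negbK (valP c).
Qed.

Lemma tile_cornerK T : tile_of (val (tile_corner T)) = T.
Proof. exact/eqP/(xchooseP (tile_black_cornerP T)). Qed.

Lemma prod_tile_corners (A : comPzRingType) (F : black_corner X -> A) :
  \prod_c F c = \prod_T (F (tile_corner T) * F (opposite (tile_corner T))).
Proof.
rewrite (partition_big (fun c => tile_of (val c)) xpredT) //=.
apply: eq_bigr => T _; set c := tile_corner T.
under eq_bigl => c' do rewrite -[X in _ == X]tile_cornerK tile_of_eq.
rewrite (bigD1 c) ?eqxx //= (bigD1 (opposite c)) /=; last first.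
  by rewrite eqxx orbT opposite_neq.
rewrite big_pred0 ?mulr1 // => c'.
by case: eqP => //=; case: eqP => //=; rewrite ?andbF.
Qed.

Lemma across_blackP c : black (origin (reverse X (next_side X (val c)))).
Proof. by rewrite black_reverse black_next negbK (valP c). Qed.

(* [across c] is the edge from the white corner after [c] to the opposite black
   corner, seen from the neighbouring tile: there it leaves its black end. *)
Definition across c : black_corner X :=
  exist _ (reverse X (next_side X (val c))) (across_blackP c).

Lemma across_inj : injective across.
Proof. by move=> c c' /(congr1 val)/= /perm_inj/perm_inj/val_inj. Qed.

Lemma corner_black_across c :
  corner_black (across c) = corner_black (opposite c).
Proof. by apply: val_inj; rewrite /= origin_next. Qed.

Lemma corner_white_across c : corner_white (across c) = corner_white c.
Proof. by apply: val_inj; rewrite /= origin_next reverse_involutive. Qed.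

(** The left side runs over the edges, each seen from the tile where it leaves its black end;
    reindexing by [across] sees it from the tile on its other side. *)
Lemma prod_edges (A : comPzRingType)
    (f : white_vertex X -> black_vertex X -> A) :
  \prod_T (f (tile_U T) (tile_P T) * f (tile_W T) (tile_Q T)) =
  \prod_T (f (tile_U T) (tile_Q T) * f (tile_W T) (tile_P T)).
Proof.
rewrite -(prod_tile_corners (fun c => f (corner_white c) (corner_black c))).
rewrite (reindex_inj across_inj) /=.
under eq_bigr => c _ do rewrite corner_black_across corner_white_across.
rewrite (prod_tile_corners
  (fun c => f (corner_white c) (corner_black (opposite c)))).
by apply: eq_bigr => T _; rewrite oppositeK.
Qed.

End BlackCorners.

Lemma white_class_of_eq (X : bicolored_tiling) (E : equiv_rel (white_vertex X))
    (u w : white_vertex X) : E u w -> white_class_of E u = white_class_of E w.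
Proof.
move=> uw; apply: val_inj; apply/setP => y /=; rewrite !inE /=.
exact: (equiv_ltrans uw).
Qed.

Theorem theorem1p5 (X : bicolored_tiling) (E : equiv_rel (white_vertex X))
    (T0 : tile X) (UW0 : ~~ E (tile_U T0) (tile_W T0)) :
  absolute (tiling_incidence_theorem UW0).
Proof.
move=> A M colM _ ndM colinM; rewrite /= in M colM ndM colinM *.
pose v a := column_vec M a.
(* Coordinates of the line through [s_i] and [t_i]. *)
pose l i := cross (v (elt_s i)) (v (elt_t i)).
pose cl := white_class_of E.
pose f w P := dot (l (cl w)) (v (elt_black E P)).
have meet_l (k : class_pair E) i : i \in val k -> dot (l i) (v (elt_R k)) = 0.
  by move=> ik; rewrite -minor3E; apply: colinM; apply: Collinear_stR.
have lU T (UW : ~~ E (tile_U T) (tile_W T)) :=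
  meet_l (tile_pair UW) _ (set21 (cl (tile_U T)) (cl (tile_W T))).
have lW T (UW : ~~ E (tile_U T) (tile_W T)) :=
  meet_l (tile_pair UW) _ (set22 (cl (tile_U T)) (cl (tile_W T))).
have uf T w P : w = tile_U T \/ w = tile_W T -> P = tile_P T \/ P = tile_Q T ->
    is_unit (f w P).
  move=> wT PT; rewrite /f -minor3E; apply: ndM; apply: Nondeg_stP.
  by exists T; split=> //; case: wT => ->; [left | right].
pose F T := f (tile_U T) (tile_P T) * f (tile_W T) (tile_Q T).
pose G T := f (tile_U T) (tile_Q T) * f (tile_W T) (tile_P T).
have FG : F T0 = G T0.
  apply: (prod_eq_cancel (i0 := T0)) (prod_edges f) => T; last first.
    by apply: is_unitM; apply: (uf T); auto.
  (* A tile with equivalent white vertices carries no collinearity condition, but there [F T = G T]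
     by commutativity. *)
  move=> TT0; have [UW | UW] := boolP (E (tile_U T) (tile_W T)).
    by rewrite /F /G /f /cl (white_class_of_eq UW) mulrC.
  have [c cR] := column_vec_unimodular (colM (elt_R (tile_pair UW))).
  rewrite /F /G [RHS]mulrC.
  apply: collinear_meet_cross (lU T UW) (lW T UW) cR _.
  by rewrite -minor3E; apply: colinM; apply: Collinear_tile.
have nUW := white_class_of_neq UW0.
(* With [i], [j] the classes at [T0], the two units are the minors of [s_i, t_i, t_j] and
   [s_j, t_j, s_i]. *)
rewrite minor3E; apply: cross_collinear_meet (lU T0 UW0) (lW T0 UW0) _ _ _.
- by rewrite -minor3E; apply: ndM; apply: Nondeg_sititj.
- by rewrite -minor3E; apply: ndM; apply: Nondeg_sitisj; rewrite eq_sym.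
by rewrite [RHS]mulrC; apply: FG.
Qed.
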